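(* Let $P$ be a natural unit interval order on $[n]$. Then the sequence $(a_{P,j}(q))_{0\le j\le |E(\mathrm{inc}(P))|}$ is palindromic, i.e., $a_{P,j}(q)=a_{P,\,|E(\mathrm{inc}(P))|-j}(q)$ for all $0\le j\le |E(\mathrm{inc}(P))|$.
   Context: A natural unit interval order is a poset $P$ on $[n]$ such that (1) $x<_P y$ implies $x<y$ as integers, and (2) whenever the disjoint union of a chain $x<_P z$ and an element $y$ (incomparable to both) is an induced subposet of $P$, then $x<y<z$ as integers. The incomparability graph $\mathrm{inc}(P)$ has vertex set $[n]$ and edges $\{a,b\}$ with $a,b$ incomparable in $P$; $E(\cdot)$ denotes edge set. For a graph $G$ on $[n]$ and $\sigma\in\mathfrak S_n$, $\mathrm{inv}_G(\sigma)=|\{(i,j):i<j,\ \sigma(i)>\sigma(j),\ \{\sigma(i),\sigma(j)\}\in E(G)\}|$. For a poset $P$ on $[n]$, $\mathrm{Des}_P(\sigma)=\{i\in[n-1]:\sigma(i)>_P\sigma(i+1)\}$ and $\mathrm{maj}_P(\sigma)=\sum_{i\in\mathrm{Des}_P(\sigma)}i$. Then $a_{P,j}(q)=\sum_{\sigma\in\mathfrak S_n,\ \mathrm{inv}_{\mathrm{inc}(P)}(\sigma)=j}q^{\mathrm{maj}_P(\sigma)}$. *)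

(* Defs.v *)
From mathcomp Require Import all_boot all_order all_algebra all_fingroup.

Set Implicit Arguments.
Unset Strict Implicit.
Unset Printing Implicit Defensive.

Import GRing.Theory.
Local Open Scope ring_scope.

(* [n] is represented by 'I_n, so integers and positions are shifted down by
   one; a poset on [n] is given by its strict order relation lt_P. *)

Definition strict_poset (n : nat) (lt_P : rel 'I_n) : Prop :=
  irreflexive lt_P /\ transitive lt_P.

Definition incomparable (n : nat) (lt_P : rel 'I_n) (a b : 'I_n) : bool :=
  [&& a != b, ~~ lt_P a b & ~~ lt_P b a].

Definition natural_unit_interval_order (n : nat) (lt_P : rel 'I_n) : Prop :=
  [/\ strict_poset lt_P,
      (forall x y : 'I_n, lt_P x y -> (x < y)%N)
    & (forall x y z : 'I_n, lt_P x z ->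
         incomparable lt_P x y -> incomparable lt_P y z ->
         (x < y < z)%N)].

(* A simple graph on [n] is given by its set of edges {a, b}. *)
Definition inc_edges (n : nat) (lt_P : rel 'I_n) : {set {set 'I_n}} :=
  [set [set p.1; p.2] | p : 'I_n * 'I_n & incomparable lt_P p.1 p.2].

Definition inv_graph (n : nat) (E : {set {set 'I_n}}) (s : 'S_n) : nat :=
  #|[set p : 'I_n * 'I_n |
      [&& (p.1 < p.2)%N, (s p.2 < s p.1)%N & [set s p.1; s p.2] \in E]]|.

Definition Des (n : nat) (lt_P : rel 'I_n) (s : 'S_n) : {set 'I_n} :=
  [set i : 'I_n |
    [exists k : 'I_n, (k == i.+1 :> nat) && lt_P (s k) (s i)]].

(* i : 'I_n stands for the position i.+1 of [n]. *)
Definition maj (n : nat) (lt_P : rel 'I_n) (s : 'S_n) : nat :=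
  (\sum_(i in Des lt_P s) i.+1)%N.

Definition a_poly (n : nat) (lt_P : rel 'I_n) (j : nat) : {poly int} :=
  \sum_(s : 'S_n | inv_graph (inc_edges lt_P) s == j) 'X^(maj lt_P s).

(* Main.v *)
Require Import Defs.
From mathcomp Require Import all_boot all_order all_algebra all_fingroup.
From mathcomp Require Import zify.

(* Cutting a permutation [s] after each position outside a set [D] of P-descents
   splits [n] into P-chains, that is, properly colors the incomparability
   graph with a content depending only on [D], and [inv_graph] becomes the
   number of edges whose larger end has the smaller color. Hence the
   permutations with [D \subset Des s] and [inv = j] are counted by a
   coefficient of the chromatic quasisymmetric function of Shareshian and
   Wachs. Reversing the colors replaces [j] by [|E| - j] and reverses the
   content. For a natural unit interval order the vertices of two adjacent
   colors induce a disjoint union of monotone paths; exchanging the two colors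
   on the paths with an odd number of vertices preserves [j] and transposes the
   content, so the counts are symmetric in the content and the reversal is
   harmless. The counts for all [D] determine [a_poly], because ['X^(maj s)] is
   the sum over [D \subset Des s] of [\prod_(i in D) ('X^(i.+1) - 1)]. *)

Set Implicit Arguments.
Unset Strict Implicit.
Unset Printing Implicit Defensive.

Import Order.TTheory GRing.Theory.

Local Open Scope order_scope.

Lemma eq_set2 (T : finType) (a b x y : T) :
  [set a; b] = [set x; y] -> (a = x /\ b = y) \/ (a = y /\ b = x).
Proof.
move/setP=> eq_ab; move: (eq_ab a) (eq_ab b) (eq_ab x) (eq_ab y).
rewrite !inE !eqxx !orbT /=.
move=> /esym/pred2P a_xy /esym/pred2P b_xy /pred2P x_ab /pred2P y_ab.
by intuition congruence.
Qed.

Section FiniteSums.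

Local Open Scope ring_scope.

Lemma prod_sum_subsets (R : comNzRingType) (I : finType) (A : {set I})
    (F : I -> R) :
  \prod_(i in A) F i =
    \sum_(B : {set I} | B \subset A) \prod_(i in B) (F i - 1).
Proof.
transitivity (\prod_i ((if i \in A then F i - 1 else 0) + 1)).
  rewrite big_mkcond; apply: eq_bigr => i _.
  by case: ifP; rewrite ?subrK ?add0r.
rewrite bigA_distr [RHS]big_mkcond; apply: eq_bigr => B _ /=.
case: ifPn => [/subsetP sBA | /subsetPn[i iB iA]].
  by rewrite [RHS]big_mkcond; apply: eq_bigr => i _; case: ifP => // /sBA->.
by rewrite (bigD1 i) //= iB (negPf iA) mul0r.
Qed.

Lemma sum_signs (I : finType) (P g : pred I) :
  \sum_(i | P i) (-1) ^+ g i
    = #|[set i | P i & ~~ g i]|%:Z - #|[set i | P i & g i]|%:Z :> int.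
Proof.
rewrite (bigID g) /= addrC !cardsE; congr (_ + _).
  rewrite (eq_bigr (fun=> 1)) => [|i /andP[_ /negPf->//]].
  by rewrite sumr_const natz.
rewrite (eq_bigr (fun=> -1)) => [|i /andP[_ ->//]].
by rewrite sumr_const mulNrn natz.
Qed.

Lemma sum_signs_eq0P (I : finType) (P g : pred I) :
  \sum_(i | P i) (-1) ^+ g i = 0 :> int <->
  #|[set i | P i & g i]| = #|[set i | P i & ~~ g i]|.
Proof. by rewrite sum_signs; lia. Qed.

Lemma odd_sum_signs (I : finType) (P g : pred I) :
  odd `|(\sum_(i | P i) (-1) ^+ g i : int)| = odd #|P|.
Proof.
have -> : #|P| = (#|[set i | P i & ~~ g i]| + #|[set i | P i & g i]|)%N.
  rewrite -(cardID g P) addnC !cardsE.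
  by congr (_ + _)%N; apply: eq_card => i; rewrite !inE andbC.
by rewrite sum_signs; lia.
Qed.

Lemma sum_closed_eq0 (T : finType) (e : rel T) (V : nmodType) (A : {pred T})
    (F : T -> V) :
  symmetric e -> closed e A ->
  (forall x, x \in A -> \sum_(y | connect e x y) F y = 0) ->
  \sum_(x in A) F x = 0.
Proof.
move=> /sym_connect_sym e_csym clA F0.
have root_A x :
    x \in A -> (fingraph.root e x \in A) && roots e (fingraph.root e x).
  by rewrite roots_root // andbT (closed_connect clA (connect_root e x)).
rewrite (partition_big (fingraph.root e) [pred r in A | roots e r]) //=.
apply: big1 => r /andP[rA /eqP root_r]; rewrite -[RHS](F0 r rA).
apply: eq_bigl => y.
rewrite -{1}root_r root_connect // e_csym andb_idl // => cry.
by rewrite -(closed_connect clA cry).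
Qed.

End FiniteSums.

Lemma perm_ind_adjacent m (K : 'S_m -> Prop) :
  K 1%g -> (forall s t, K s -> K t -> K (s * t)%g) ->
  (forall c d : 'I_m, d = c.+1 :> nat -> K (tperm c d)) ->
  forall s, K s.
Proof.
move=> K1 KM K_adj s.
have K_lt (b a : 'I_m) : (a < b)%N -> K (tperm a b).
  case: b => b lt_bm; elim: b lt_bm => // b IHb lt_bm /= le_ab.
  have [eq_ab | ne_ab] := eqVneq (a : nat) b.
    by apply: K_adj; rewrite eq_ab.
  pose b' := Ordinal (ltnW lt_bm); pose b1 := Ordinal lt_bm.
  have -> : tperm a b1 = (tperm b' b1 * tperm a b' * tperm b' b1)%g.
    have := tpermJ a b' (tperm b' b1); rewrite /conjg tpermV mulgA tpermL => ->.
    by rewrite tpermD // -val_eqE /=; lia.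
  have K_swap : K (tperm b' b1) by apply: K_adj.
  apply: (KM _ _ _ K_swap); apply: (KM _ _ K_swap); apply: IHb => /=; lia.
have [ts -> _] := prod_tpermP s.
elim: ts => [|[a b] ts IHts]; rewrite ?big_nil ?big_cons //=; apply: KM => //.
case: (ltngtP a b) => [||/val_inj->]; first exact: K_lt.
  by rewrite tpermC; apply: K_lt.
by rewrite tperm1.
Qed.

Definition content (T : finType) (C : eqType) (f : T -> C) (c : C) : nat :=
  #|[set x | f x == c]|.

Lemma content_perm (T : finType) (C : eqType) (f : T -> C) (s : {perm T}) :
  content (f \o s) =1 content f.
Proof.
move=> c; rewrite -[LHS](card_imset _ (@perm_inj _ s)); apply: eq_card => x.
by rewrite -[x](permKV s) (mem_imset _ _ perm_inj) !inE.
Qed.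

Section SortingPermutations.

Variables (disp : Order.disp_t) (T : orderType disp) (n : nat).
Implicit Types f g : 'I_n -> T.

Lemma nondecreasing_content_inj f g :
  {homo f : p q / p <= q} -> {homo g : p q / p <= q} ->
  content f =1 content g -> f =1 g.
Proof.
move=> f_mono g_mono eq_fg.
have enum_sorted : sorted <=%O (enum 'I_n).
  by have := iota_sorted 0 n; rewrite -val_enum_ord sorted_map.
have /eq_in_map eq_f : map f (enum 'I_n) = map g (enum 'I_n).
  apply: le_sorted_eq; [exact: homo_sorted enum_sorted.. |].
  apply/allP => c _; rewrite /= !count_map; apply/eqP.
  by have := eq_fg c; rewrite /content !cardsE !cardE !size_filter -enumT.
by move=> p; apply: eq_f; rewrite mem_enum.
Qed.

Lemma sorting_perm_exists f : exists s : 'S_n, {homo f \o s : p q / p <= q}.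
Proof.
pose t := sort_tuple (relpre f <=%O) (ord_tuple n).
have t_inj : injective (tnth t).
  by apply/tuple_uniqP; rewrite sort_uniq /= enum_uniq.
exists (perm t_inj) => p q le_pq /=; rewrite !permE !(tnth_nth p).
have t_sorted : sorted (relpre f <=%O) t.
  by apply: sort_sorted => x y; apply: le_total.
have f_trans : transitive (relpre f <=%O) by move=> y x z; apply: le_trans.
by apply: (sorted_leq_nth f_trans (fun x => lexx (f x)) _ t_sorted);
  rewrite ?inE ?size_tuple.
Qed.

Lemma sorting_perm_uniq f (s t : 'S_n) : injective f ->
  {homo f \o s : p q / p <= q} -> {homo f \o t : p q / p <= q} -> s = t.
Proof.
move=> f_inj s_mono t_mono; apply/permP => p; apply: f_inj.
apply: (nondecreasing_content_inj s_mono t_mono) => c.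
by rewrite !content_perm.
Qed.

End SortingPermutations.

(* The neighbors of a vertex are the next smaller and the next larger vertices
   of its component, so that the components are monotone paths. *)
Definition neighbors_consecutive disp (T : finOrderType disp) (e : rel T) :=
  forall x y z, e x y -> x < z -> z < y -> ~~ connect e x z.

Section SmallerNeighbors.

Variables (disp : Order.disp_t) (T : finOrderType disp) (e : rel T).
Hypotheses (e_sym : symmetric e) (e_consec : neighbors_consecutive e).

Lemma exists_smaller_neighbor x y :
  connect e x y -> x < y -> exists2 a, e a y & a < y.
Proof.
move=> cxy; have /connectP[p] := cxy.
elim: p x cxy => [|v p IHp] x cxy /=; first by move=> _ ->; rewrite ltxx.
case/andP=> exv ep y_last lt_xy; case: (ltgtP v y) => [lt_vy | lt_yv | eq_vy].
- apply: IHp ep y_last lt_vy.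
  by rewrite -(same_connect1 (sym_connect_sym e_sym) exv).
- by have := e_consec exv lt_xy lt_yv; rewrite cxy.
- by exists x; rewrite -?eq_vy // eq_vy.
Qed.

Lemma smaller_neighbor_uniq a b y : e a y -> a < y -> e b y -> b < y -> a = b.
Proof.
wlog lt_ab : a b / a < b => [wlog_lt|] eay lt_ay eby lt_by.
  by case: (ltgtP a b) => [lt_ab|lt_ba|//]; [|apply/esym]; apply: wlog_lt.
have := e_consec eay lt_ab lt_by.
by rewrite (connect_trans (connect1 eay)) // connect1 // e_sym.
Qed.

Local Open Scope ring_scope.

(* Every vertex of a component but the smallest has exactly one smaller
   neighbor. *)
Lemma sum_smaller_neighbors (V : zmodType) (F : T -> V) x :
  exists m, \sum_(y | connect e x y) \sum_(a | e a y && (a < y)%O) F y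
            = \sum_(y | connect e x y) F y - F m.
Proof.
have e_csym := sym_connect_sym e_sym.
case: (@arg_minP _ _ _ x (connect e x) id (connect0 e x)) => m cxm m_min.
have connect_m y : connect e x y = connect e m y by apply: same_connect.
exists m; rewrite (bigD1 m) //= [X in _ = X - _](bigD1 m) //= [RHS]addrC addKr.
rewrite big_pred0 ?add0r => [|a]; last first.
  apply/negP => /andP[eam lt_am]; have := m_min a.
  by rewrite connect_m e_csym connect1 // leNgt lt_am => /(_ isT).
apply: eq_bigr => y /andP[cxy ne_ym].
have lt_my : (m < y)%O by rewrite lt_neqAle eq_sym ne_ym m_min.
have [|a eay lt_ay] := exists_smaller_neighbor _ lt_my.
  by rewrite -connect_m.
rewrite (big_pred1 a) // => b; apply/andP/eqP => [[eby lt_by] | ->] //.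
exact: smaller_neighbor_uniq eby lt_by eay lt_ay.
Qed.

End SmallerNeighbors.

Lemma neighbors_consecutive_dual disp (T : finOrderType disp) (e : rel T) :
  symmetric e -> neighbors_consecutive e -> @neighbors_consecutive _ T^d e.
Proof.
move=> e_sym e_consec x y z exy; rewrite !ltEdual => lt_zx lt_yz.
rewrite (same_connect1 (sym_connect_sym e_sym) exy).
by apply: e_consec lt_yz lt_zx; rewrite e_sym.
Qed.

Section AlternatingPaths.

Variables (disp : Order.disp_t) (T : finOrderType disp) (e : rel T).
Variables (g : pred T) (x : T).
Hypotheses (e_sym : symmetric e) (e_consec : neighbors_consecutive e).
Hypothesis g_alt : forall y z, e y z -> g y != g z.

Local Open Scope ring_scope.

Local Notation sign y := ((-1) ^+ g y : int).
Local Notation sum_edges :=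
  (\sum_(y | connect e x y) \sum_(a | e a y && (a < y)%O) sign y).
Local Notation sum_vertices := (\sum_(y | connect e x y) sign y).

Lemma sum_larger_neighbors_sign :
  \sum_(y | connect e x y) \sum_(b | e b y && (y < b)%O) sign y = - sum_edges.
Proof.
rewrite (exchange_big_dep (connect e x)) /=; last first.
  move=> y b cxy /andP[eby _].
  by apply: connect_trans cxy _; rewrite connect1 // e_sym.
rewrite -sumrN; apply: eq_bigr => b cxb; rewrite -sumrN.
apply: eq_big => [y|y /and3P[_ eby _]]; last first.
  by move: (g_alt eby); case: (g b); case: (g y); rewrite ?opprK.
rewrite [e b y]e_sym; case: (boolP (e y b)) => [eyb|]; rewrite ?andbF //=.
by rewrite (connect_trans cxb) // connect1 // e_sym.
Qed.

(* A component is a monotone path with alternating signs; counting each edge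
   once at its upper end and once at its lower end gives the second equation. *)
Lemma sum_signs_path : exists b c : bool,
  sum_edges = sum_vertices - (-1) ^+ b /\
  sum_vertices *+ 2 = (-1) ^+ b + (-1) ^+ c.
Proof.
have [m sum_m] := sum_smaller_neighbors e_sym e_consec (fun y => sign y) x.
have [M] := @sum_smaller_neighbors _ T^d e e_sym
              (neighbors_consecutive_dual e_sym e_consec) _ (fun y => sign y) x.
rewrite sum_larger_neighbors_sign => sum_M.
exists (g m), (g M); split; first exact: sum_m.
move: sum_m sum_M; move: sum_edges sum_vertices (sign m) (sign M).
by lia.
Qed.

Lemma sum_edges_odd_path : odd #|connect e x| -> sum_edges = 0.
Proof.
rewrite -(odd_sum_signs _ g); have [b [c [-> ]]] := sum_signs_path.
by move: sum_vertices => s; case: b c => [] []; rewrite ?expr0 ?expr1; lia.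
Qed.

Lemma sum_vertices_even_path : ~~ odd #|connect e x| -> sum_vertices = 0.
Proof.
rewrite -(odd_sum_signs _ g); have [b [c [_ ]]] := sum_signs_path.
by move: sum_vertices => s; case: b c => [] []; rewrite ?expr0 ?expr1; lia.
Qed.

End AlternatingPaths.

Section EdgeSets.

Variables (disp : Order.disp_t) (T : finOrderType disp) (e : rel T).
Hypothesis e_sym : symmetric e.

Definition num_edges := #|[set p : T * T | (p.2 < p.1) && e p.1 p.2]|.

Definition edge_set := [set [set p.1; p.2] | p : T * T & e p.1 p.2].

Lemma mem_edge_set x y : ([set x; y] \in edge_set) = e x y.
Proof.
apply/imsetP/idP => [[[a b]]|exy]; last by exists (x, y); rewrite ?inE.
by rewrite inE => eab /eq_set2[] [-> ->]; rewrite // e_sym.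
Qed.

Lemma card_edge_set : irreflexive e -> #|edge_set| = num_edges.
Proof.
move=> e_irr.
rewrite /num_edges -(card_in_imset (f := fun p => [set p.1; p.2])).
  apply: eq_card => A; apply/imsetP/imsetP => -[[a b]]; last first.
    by rewrite inE => /andP[_ eab] ->; exists (a, b); rewrite ?inE.
  rewrite inE /= => eab ->; case: (ltgtP a b) => [lt_ab|lt_ba|eq_ab].
  - by exists (b, a); rewrite ?inE /= 1?lt_ab 1?e_sym // setUC.
  - by exists (a, b); rewrite ?inE /= ?lt_ba.
  - by rewrite eq_ab e_irr in eab.
move=> [a b] [a' b']; rewrite !inE /= => /andP[lt_ba _] /andP[lt_ba' _].
case/eq_set2=> -[eq_a eq_b].
  by rewrite eq_a eq_b.
by rewrite eq_a eq_b ltNge (ltW lt_ba') in lt_ba.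
Qed.

End EdgeSets.

Section Colorings.

Variables (disp : Order.disp_t) (T : finOrderType disp) (e : rel T) (m : nat).
Implicit Types (k : {ffun T -> 'I_m}) (alpha : 'I_m -> nat).

Definition proper_coloring k := [forall x, forall y, e x y ==> (k x != k y)].

Definition descent_edges k :=
  [set p : T * T | [&& p.2 < p.1, e p.1 p.2 & (k p.1 < k p.2)%N]].

Definition colorings j alpha :=
  [set k | [&& proper_coloring k, #|descent_edges k| == j
             & [forall c, content k c == alpha c]]].

Lemma proper_coloringP k :
  reflect (forall x y, e x y -> k x != k y) (proper_coloring k).
Proof.
by apply: (iffP 'forall_forallP) => k_proper x y;
  [apply/implyP | apply/implyP/k_proper].
Qed.

Lemma eq_colorings j alpha beta :
  alpha =1 beta -> colorings j alpha = colorings j beta.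
Proof.
move=> eq_ab; apply/setP => k.
by rewrite !inE (eq_forallb (fun c => congr1 _ (eq_ab c))).
Qed.

Lemma card_colorings_involution (f : {ffun T -> 'I_m} -> {ffun T -> 'I_m})
    (s : 'I_m -> 'I_m) j j' alpha :
  involutive f -> involutive s ->
  (forall k, proper_coloring k ->
    [/\ proper_coloring (f k),
        (#|descent_edges (f k)| == j') = (#|descent_edges k| == j)
      & forall c, content (f k) c = content k (s c)]) ->
  #|colorings j' (alpha \o s)| = #|colorings j alpha|.
Proof.
move=> fK sK f_colorings; rewrite -(card_imset _ (inv_inj fK)).
apply: eq_card => k; rewrite -[k in LHS]fK (mem_imset _ _ (inv_inj fK)) !inE.
have f_proper : proper_coloring (f k) = proper_coloring k.
  by apply/idP/idP => /f_colorings[]; rewrite ?fK.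
rewrite f_proper; case: (boolP (proper_coloring k)) => //=.
case/f_colorings=> _ -> f_content; congr andb.
apply/forallP/forallP => k_content c; have /= := k_content (s c).
  by rewrite f_content !sK.
by rewrite f_content.
Qed.

Definition reverse_colors k : {ffun T -> 'I_m} := [ffun x => rev_ord (k x)].

Lemma reverse_colorsK : involutive reverse_colors.
Proof. by move=> k; apply/ffunP => x; rewrite !ffunE rev_ordK. Qed.

Lemma proper_reverse_colors k :
  proper_coloring k -> proper_coloring (reverse_colors k).
Proof.
move/proper_coloringP=> k_proper; apply/proper_coloringP => x y /k_proper.
by rewrite !ffunE (inj_eq rev_ord_inj).
Qed.

Lemma card_descent_edges_reverse k : proper_coloring k ->
  (#|descent_edges (reverse_colors k)| + #|descent_edges k| = num_edges e)%N.
Proof.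
move/proper_coloringP=> k_proper; rewrite /num_edges addnC.
rewrite -(cardsID [set p | (k p.1 < k p.2)%N] [set p | _ && e _ _]).
congr (_ + _)%N; apply: eq_card => -[x y]; rewrite !inE /= ?andbA // !ffunE /=.
case: (boolP (e x y)) => [/k_proper|]; rewrite ?andbF //= -val_eqE /= andbC.
by have := ltn_ord (k x); have := ltn_ord (k y); lia.
Qed.

Lemma content_reverse_colors k c :
  content (reverse_colors k) c = content k (rev_ord c).
Proof.
by apply: eq_card => x; rewrite !inE ffunE (can2_eq rev_ordK rev_ordK).
Qed.

Lemma card_colorings_reverse j alpha : (j <= num_edges e)%N ->
  #|colorings (num_edges e - j) (alpha \o @rev_ord m)| = #|colorings j alpha|.
Proof.
move=> le_jE.
apply: card_colorings_involution reverse_colorsK (@rev_ordK m) _ => k k_proper.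
split; [exact: proper_reverse_colors | | exact: content_reverse_colors].
by have := card_descent_edges_reverse k_proper; lia.
Qed.

End Colorings.

(* The vertex orderings that characterize unit interval graphs. *)
Definition umbrella disp (T : finOrderType disp) (e : rel T) :=
  forall x y z, x < y -> y < z -> e x z -> e x y /\ e y z.

Section BenderKnuth.

Variables (disp : Order.disp_t) (T : finOrderType disp) (e : rel T).
Hypotheses (e_sym : symmetric e) (e_umbrella : umbrella e).
Variables (m : nat) (c d : 'I_m).
Hypothesis d_succ : d = c.+1 :> nat.
Implicit Types (k : {ffun T -> 'I_m}).

Let neq_cd : (c == d) = false.
Proof. by rewrite -val_eqE /= d_succ; lia. Qed.

Let neq_dc : (d == c) = false.
Proof. by rewrite eq_sym neq_cd. Qed.

Definition two_colored k x := (k x == c) || (k x == d).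

Definition two_color_edge k x y :=
  [&& two_colored k x, two_colored k y & e x y].

Definition odd_component k x := odd #|connect (two_color_edge k) x|.

Definition bender_knuth k : {ffun T -> 'I_m} :=
  [ffun x => if odd_component k x then tperm c d (k x) else k x].

Lemma two_color_edge_sym k : symmetric (two_color_edge k).
Proof. by move=> x y; rewrite /two_color_edge andbCA e_sym. Qed.

Lemma connect_two_color_edge_sym k : connect_sym (two_color_edge k).
Proof. exact: sym_connect_sym (@two_color_edge_sym k). Qed.

Lemma odd_component_edge k x y :
  two_color_edge k x y -> odd_component k x = odd_component k y.
Proof.
move=> exy; congr odd.
exact: eq_card (same_connect1 (@connect_two_color_edge_sym k) exy).
Qed.

Lemma two_colored_bender_knuth k x :
  two_colored (bender_knuth k) x = two_colored k x.
Proof.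
rewrite /two_colored ffunE; case: ifP => // _.
rewrite ![tperm _ _ _ == _](can2_eq (tpermK _ _) (tpermK _ _)).
by rewrite tpermL tpermR orbC.
Qed.

Lemma odd_component_bender_knuth k x :
  odd_component (bender_knuth k) x = odd_component k x.
Proof.
congr odd; apply: eq_card; apply: eq_connect => y z.
by rewrite /two_color_edge !two_colored_bender_knuth.
Qed.

Lemma bender_knuthK : involutive bender_knuth.
Proof.
move=> k; apply/ffunP => x; rewrite ffunE odd_component_bender_knuth ffunE.
by case: (odd_component k x); rewrite ?tpermK.
Qed.

Lemma bender_knuth_id k x : ~~ two_colored k x -> bender_knuth k x = k x.
Proof.
rewrite ffunE negb_or => /andP[nc nd]; case: ifP => // _.
by rewrite tpermD // eq_sym.
Qed.

Lemma connect_two_colored k x y :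
  connect (two_color_edge k) x y -> x != y -> two_colored k x.
Proof.
case/connectP => -[|z p] /=; first by move=> _ ->; rewrite eqxx.
by case/andP => /and3P[].
Qed.

Lemma even_component_two_colored k x : ~~ odd_component k x -> two_colored k x.
Proof.
apply: contraR => nx; rewrite /odd_component (@eq_card1 _ x) // => y.
rewrite unfold_in inE [y == x]eq_sym.
apply/idP/eqP => [cxy | ->]; last exact: connect0.
by apply: contraNeq nx => /(connect_two_colored cxy).
Qed.

Lemma two_colored_neq_c k x : two_colored k x -> (k x != c) = (k x == d).
Proof. by case/orP=> /eqP->; rewrite !eqxx ?neq_cd ?neq_dc. Qed.

Lemma two_colored_neq k x y : two_colored k x != two_colored k y -> k x != k y.
Proof. by apply: contraNneq; rewrite /two_colored => ->. Qed.

Lemma proper_bender_knuth k :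
  proper_coloring e k -> proper_coloring e (bender_knuth k).
Proof.
move=> /proper_coloringP k_proper; apply/proper_coloringP => x y exy.
have [eq_cd | ne_cd] := eqVneq (two_colored k x) (two_colored k y); last first.
  by apply: two_colored_neq; rewrite !two_colored_bender_knuth.
have [x_cd | x_cd] := boolP (two_colored k x); last first.
  by rewrite !bender_knuth_id -?eq_cd // k_proper.
have Exy : two_color_edge k x y by apply/and3P; rewrite -eq_cd.
rewrite !ffunE -(odd_component_edge Exy).
by case: ifP => _; rewrite ?(inj_eq perm_inj) k_proper.
Qed.

Lemma ltn_bender_knuth k x y : e x y -> ~~ two_color_edge k x y ->
  (bender_knuth k x < bender_knuth k y)%N = (k x < k y)%N.
Proof.
rewrite /two_color_edge => -> /[!andbT].
have val_id z : ~~ two_colored k z -> bender_knuth k z = k z :> nat.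
  by move/bender_knuth_id->.
move: (val_id x) (val_id y) (two_colored_bender_knuth k x).
move: (two_colored_bender_knuth k y); rewrite /two_colored -!val_eqE /= d_succ.
move: (bender_knuth k x : nat) (bender_knuth k y : nat) (k x : nat) (k y : nat).
by lia.
Qed.

Section FixedColoring.

Variable k : {ffun T -> 'I_m}.
Hypothesis k_proper : proper_coloring e k.

Local Notation E := (two_color_edge k).

Lemma two_color_edge_alternates x y : E x y -> (k x == c) != (k y == c).
Proof.
case/and3P=> /orP[]/eqP kx /orP[]/eqP ky /(proper_coloringP _ _ k_proper);
  by rewrite kx ky ?eqxx ?neq_cd ?neq_dc.
Qed.

Lemma two_color_edge_consecutive : neighbors_consecutive E.
Proof.
move=> x y z Exy lt_xz lt_zy; apply/negP => cxz.
have z_cd : two_colored k z.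
  apply: (@connect_two_colored k z x); last by rewrite gt_eqF.
  by rewrite connect_two_color_edge_sym.
have [x_cd y_cd exy] := and3P Exy.
have [exz ezy] := e_umbrella lt_xz lt_zy exy.
have Exz : E x z by apply/and3P.
have Ezy : E z y by apply/and3P.
move: (two_color_edge_alternates Exz) (two_color_edge_alternates Ezy)
  (two_color_edge_alternates Exy).
by case: (k x == c); case: (k y == c); case: (k z == c).
Qed.

Definition switched_edges :=
  [set p : T * T | [&& odd_component k p.1, E p.1 p.2 & p.2 < p.1]].

Lemma switched_edges_balanced :
  #|[set p in switched_edges | k p.1 == c]| =
  #|[set p in switched_edges | k p.1 == d]|.
Proof.
transitivity #|[set p in switched_edges | k p.1 != c]|; last first.
  apply: eq_card => -[x y]; rewrite !inE.
  by apply: andb_id2l => /and3P[_ /and3P[/= /two_colored_neq_c]].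
apply/(@sum_signs_eq0P _ (mem switched_edges) (fun p => k p.1 == c)).
transitivity (\sum_(x in odd_component k)
    \sum_(y | E y x && (y < x)%O) (-1) ^+ (k x == c) : int)%R.
  rewrite pair_big_dep; apply: eq_bigl => -[x y].
  by rewrite !inE two_color_edge_sym.
apply: (@sum_closed_eq0 _ E) => [|y z|x]; first exact: two_color_edge_sym.
  exact: odd_component_edge.
exact: sum_edges_odd_path (@two_color_edge_sym k) two_color_edge_consecutive
         two_color_edge_alternates.
Qed.

Lemma even_components_balanced :
  #|[set x | ~~ odd_component k x & k x == c]| =
  #|[set x | ~~ odd_component k x & k x == d]|.
Proof.
transitivity #|[set x | ~~ odd_component k x & k x != c]|; last first.
  apply: eq_card => x; rewrite !inE.
  by apply: andb_id2l => /even_component_two_colored/two_colored_neq_c.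
apply/(@sum_signs_eq0P _ (fun x => ~~ odd_component k x) (fun x => k x == c)).
apply: (@sum_closed_eq0 _ E) => [||x]; first exact: two_color_edge_sym.
  exact: predC_closed (@odd_component_edge k).
exact: sum_vertices_even_path (@two_color_edge_sym k) two_color_edge_consecutive
         two_color_edge_alternates.
Qed.

Lemma switched_edge_descent p : p \in switched_edges ->
  ((p \in descent_edges e k) = (k p.1 == c)) *
  ((p \in descent_edges e (bender_knuth k)) = (k p.1 == d)).
Proof.
case: p => x y; rewrite !inE => /and3P[/= odd_x Exy ->].
have odd_y : odd_component k y by rewrite -(odd_component_edge Exy).
rewrite !ffunE odd_x odd_y; move: (two_color_edge_alternates Exy).
case/and3P: Exy => /orP[]/eqP-> /orP[]/eqP-> -> /=;
  by rewrite ?tpermL ?tpermR ?eqxx ?neq_cd ?neq_dc // d_succ; split; lia.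
Qed.

Lemma unswitched_edge_descent p : p \notin switched_edges ->
  (p \in descent_edges e (bender_knuth k)) = (p \in descent_edges e k).
Proof.
case: p => x y; rewrite !inE /=.
have [lt_yx|//] := boolP (y < x); have [exy|//] := boolP (e x y).
have [Exy /= /[!andbT] even_x|/(ltn_bender_knuth exy)-> //] := boolP (E x y).
have even_y : ~~ odd_component k y by rewrite -(odd_component_edge Exy).
by rewrite !ffunE (negPf even_x) (negPf even_y).
Qed.

Lemma card_descent_edges_bender_knuth :
  #|descent_edges e (bender_knuth k)| = #|descent_edges e k|.
Proof.
rewrite -!(cardsID switched_edges (descent_edges _ _)).
congr (_ + _)%N; last first.
  apply: eq_card => p; rewrite !in_setD.
  by apply: andb_id2l => /unswitched_edge_descent->.
transitivity #|[set p in switched_edges | k p.1 == d]|.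
  apply: eq_card => p; rewrite in_setI [RHS]inE andbC.
  by apply: andb_id2l => /switched_edge_descent->.
rewrite -switched_edges_balanced; apply: eq_card => p.
by rewrite inE in_setI [RHS]andbC; apply: andb_id2l => /switched_edge_descent->.
Qed.

Lemma content_bender_knuth u :
  content (bender_knuth k) u = content k (tperm c d u).
Proof.
rewrite /content -!(cardsID [set x | odd_component k x] [set x | _ == _]).
congr (_ + _)%N.
  apply: eq_card => x; rewrite !inE ffunE; apply: andb_id2r => ->.
  by rewrite (can2_eq (tpermK _ _) (tpermK _ _)).
transitivity #|[set x | ~~ odd_component k x & k x == u]|.
  by apply: eq_card => x; rewrite !inE ffunE; apply: andb_id2l => /negPf->.
transitivity #|[set x | ~~ odd_component k x & k x == tperm c d u]|; last first.
  by apply: eq_card => x; rewrite !inE.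
by case: tpermP => // ->; rewrite even_components_balanced.
Qed.

End FixedColoring.

Lemma card_colorings_adjacent j alpha :
  #|colorings e j (alpha \o tperm c d)| = #|colorings e j alpha|.
Proof.
apply: card_colorings_involution bender_knuthK (tpermK c d) _ => k k_proper.
split; first exact: proper_bender_knuth; last exact: content_bender_knuth.
by rewrite card_descent_edges_bender_knuth.
Qed.

End BenderKnuth.

Section SymmetricContent.

Variables (disp : Order.disp_t) (T : finOrderType disp) (e : rel T).
Hypotheses (e_sym : symmetric e) (e_umbrella : umbrella e).
Variable m : nat.
Implicit Types (j : nat) (alpha : 'I_m -> nat).

Lemma card_colorings_perm j alpha (s : 'S_m) :
  #|colorings e j (alpha \o s)| = #|colorings e j alpha|.
Proof.
move: s alpha; apply: perm_ind_adjacent => [alpha | s t IHs IHt alpha | c d].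
- by congr #|pred_of_set _|; apply: eq_colorings => c; rewrite /= perm1.
- rewrite -[RHS]IHt -[RHS]IHs; congr #|pred_of_set _|; apply: eq_colorings => c.
  by rewrite /= permM.
- by move=> d_succ alpha; apply: card_colorings_adjacent.
Qed.

Lemma card_colorings_palindromic j alpha : (j <= num_edges e)%N ->
  #|colorings e j alpha| = #|colorings e (num_edges e - j) alpha|.
Proof.
move=> le_jE; rewrite -card_colorings_reverse //.
rewrite -(card_colorings_perm _ _ (perm rev_ord_inj)).
by congr #|pred_of_set _|; apply: eq_colorings => c; rewrite /= permE rev_ordK.
Qed.

End SymmetricContent.

Lemma incomparable_sym n (lt_P : rel 'I_n) : symmetric (incomparable lt_P).
Proof. by move=> x y; rewrite /incomparable eq_sym [X in _ && X]andbC. Qed.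

Lemma incomparable_umbrella n (lt_P : rel 'I_n) :
  natural_unit_interval_order lt_P -> umbrella (incomparable lt_P).
Proof.
case=> -[_ lt_tr] lt_nat unit_interval x y z.
rewrite !ltEord => lt_xy lt_yz ixz.
have not_below (a b : 'I_n) : (a < b)%N -> (a != b) && ~~ lt_P b a.
  by move=> lt_ab; rewrite -val_eqE neq_ltn lt_ab; apply/negP => /lt_nat; lia.
have [_ not_xz _] := and3P ixz.
have [ne_xy not_yx] := andP (not_below _ _ lt_xy).
have [ne_yz not_zy] := andP (not_below _ _ lt_yz).
have not_xy : ~~ lt_P x y.
  apply/negP => lt_Pxy; have izy : incomparable lt_P z y.
    rewrite incomparable_sym /incomparable ne_yz not_zy andbT /=.
    by apply: contraNN not_xz; apply: lt_tr.
  by have := unit_interval _ _ _ lt_Pxy ixz izy; lia.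
have ixy : incomparable lt_P x y by apply/and3P.
split=> //; apply/and3P; split=> //; apply/negP => lt_Pyz.
have := unit_interval _ x _ lt_Pyz; rewrite incomparable_sym.
by move=> /(_ ixy ixz); lia.
Qed.

Definition perms_with_descents n (lt_P : rel 'I_n) (D : {set 'I_n}) (j : nat) :
    {set 'S_n} :=
  [set s | (inv_graph (inc_edges lt_P) s == j) && (D \subset Des lt_P s)].

Section Blocks.

Variables (n : nat) (lt_P : rel 'I_n) (D : {set 'I_n}).
Hypothesis lt_tr : transitive lt_P.
Hypothesis lt_nat : forall x y, lt_P x y -> (x < y)%N.
Implicit Types (s : 'S_n) (p q : 'I_n) (k : {ffun 'I_n -> 'I_n}).

Local Notation inc := (incomparable lt_P).

Lemma block_subproof p : (#|[set i | (i < p)%O & i \notin D]| < n)%N.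
Proof.
rewrite -[ltnRHS]card_ord -cardsT; apply: proper_card; apply/properP.
by split; [apply: subsetT | exists p; rewrite !inE ?ltxx].
Qed.

(* The index of the block containing the position [p], when [n] is cut after
   each position outside [D]. *)
Definition block p : 'I_n := Ordinal (block_subproof p).

Lemma block_nondecreasing : {homo block : p q / p <= q}.
Proof.
move=> p q le_pq; apply: subset_leq_card; apply/subsetP => i; rewrite !inE.
by case/andP=> /lt_le_trans/(_ le_pq)->.
Qed.

Lemma block_succ p q : q = p.+1 :> nat -> (block q == block p) = (p \in D).
Proof.
move=> q_succ; have le_pq : p <= q by rewrite leEord q_succ.
rewrite eq_le andbC block_nondecreasing // leEord /=.
have [pD|pD] := boolP (p \in D).
  apply: subset_leq_card; apply/subsetP => i.
  rewrite !inE !ltEord q_succ ltnS leq_eqVlt.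
  by case/andP=> /orP[/eqP/val_inj->|->] //; rewrite pD.
apply/negbTE; rewrite -ltnNge; apply: proper_card; apply/properP; split.
  by apply/subsetP => i; rewrite !inE => /andP[/lt_le_trans/(_ le_pq)->].
by exists p; rewrite !inE ?ltxx // ltEord q_succ ltnSn.
Qed.

Lemma block_chain s p q : D \subset Des lt_P s ->
  p < q -> block p = block q -> lt_P (s q) (s p).
Proof.
move=> /subsetP D_des; case: q => q; elim: q => // q IHq lt_qn lt_pq eq_pq.
pose q' := Ordinal (ltnW lt_qn : (q < n)%N).
have le_pq' : p <= q' by rewrite leEord -ltnS.
have eq_block : block (Ordinal lt_qn) = block q'.
  by apply/le_anti; rewrite -{1}eq_pq !block_nondecreasing // leEord /=.
have : q' \in Des lt_P s.
  by apply: D_des; rewrite -(@block_succ q' (Ordinal lt_qn)) ?eq_block.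
rewrite inE => /existsP[r /andP[/eqP r_succ lt_r]].
have -> : Ordinal lt_qn = r by apply: val_inj.
have [-> // | ne_pq'] := eqVneq p q'.
apply: lt_tr lt_r (IHq _ _ _); last by rewrite eq_pq eq_block.
by rewrite lt_neqAle ne_pq'.
Qed.

Definition block_coloring s : {ffun 'I_n -> 'I_n} :=
  [ffun x => block (s^-1%g x)].

Lemma block_coloringE s p : block_coloring s (s p) = block p.
Proof. by rewrite ffunE permK. Qed.

Lemma content_block_coloring s : content (block_coloring s) =1 content block.
Proof.
move=> c; rewrite -(content_perm _ s); apply: eq_card => p.
by rewrite !inE /= block_coloringE.
Qed.

Lemma proper_block_coloring s : D \subset Des lt_P s ->
  proper_coloring inc (block_coloring s).
Proof.
move=> D_des; apply/proper_coloringP => x y.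
rewrite -[x](permKV s) -[y](permKV s) !block_coloringE.
move: (s^-1%g x) (s^-1%g y) => p q /and3P[ne_pq not_pq not_qp].
apply/eqP => eq_block; case: (ltgtP p q) => [lt_pq|lt_qp|eq_pq].
- by rewrite (block_chain D_des lt_pq eq_block) in not_qp.
- by rewrite (block_chain D_des lt_qp (esym eq_block)) in not_pq.
- by rewrite eq_pq eqxx in ne_pq.
Qed.

Lemma card_descent_edges_block_coloring s : D \subset Des lt_P s ->
  #|descent_edges inc (block_coloring s)| = inv_graph (inc_edges lt_P) s.
Proof.
move=> D_des; have /proper_coloringP s_proper := proper_block_coloring D_des.
pose f (p : 'I_n * 'I_n) := (s p.1, s p.2).
have f_inj : injective f by move=> [p q] [p' q'] [/perm_inj-> /perm_inj->].
rewrite -[RHS](card_imset _ f_inj); apply: eq_card => -[x y].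
rewrite -[x](permKV s) -[y](permKV s); move: (s^-1%g x) (s^-1%g y) => p q.
rewrite -[(s p, s q)]/(f (p, q)) (mem_imset _ _ f_inj) !inE /=.
rewrite (mem_edge_set (incomparable_sym lt_P)) !block_coloringE [RHS]andbCA.
apply: andb_id2l => _; rewrite andbC; apply: andb_id2r => /s_proper.
rewrite !block_coloringE => ne_block; apply/idP/idP => [|lt_pq].
  by apply: contraTT; rewrite -!leqNgt; apply: block_nondecreasing.
by rewrite ltn_neqAle ne_block; apply: block_nondecreasing; apply: ltnW.
Qed.

(* A permutation with descents at [D] is recovered from its coloring by listing
   the color classes one after the other, each in decreasing order. *)
Definition reading_key k (x : 'I_n) : 'I_n *l ('I_n)^d := (k x, x).

Lemma reading_key_inj k : injective (reading_key k).
Proof. by move=> x y []. Qed.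

Lemma reading_key_block_coloring s : D \subset Des lt_P s ->
  {homo reading_key (block_coloring s) \o s : p q / p <= q}.
Proof.
move=> D_des p q le_pq; rewrite /= /reading_key lexi_pair !block_coloringE.
rewrite block_nondecreasing //=; apply/implyP => le_block.
rewrite leEdual leEord.
have [-> // | ne_pq] := eqVneq p q.
apply/ltnW/lt_nat/(block_chain D_des); first by rewrite lt_neqAle ne_pq.
by apply/le_anti; rewrite block_nondecreasing.
Qed.

Lemma block_coloring_inj :
  {in [set s | D \subset Des lt_P s] &, injective block_coloring}.
Proof.
move=> s t; rewrite !inE => s_des t_des eq_st.
apply: (sorting_perm_uniq (@reading_key_inj (block_coloring s))).
  exact: reading_key_block_coloring.
by rewrite eq_st; apply: reading_key_block_coloring.
Qed.

Lemma block_coloring_surj k : (forall i, i \in D -> (i.+1 < n)%N) ->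
  proper_coloring inc k -> content k =1 content block ->
  exists2 s, D \subset Des lt_P s & block_coloring s = k.
Proof.
move=> D_bound /proper_coloringP k_proper k_content.
have [s s_sorts] := sorting_perm_exists (reading_key k).
have k_mono : {homo k \o s : p q / p <= q}.
  by move=> p q /s_sorts; rewrite /= lexi_pair => /andP[].
have k_block : k \o s =1 block.
  apply: (nondecreasing_content_inj k_mono block_nondecreasing) => c.
  by rewrite content_perm.
exists s; last by apply/ffunP => x; rewrite ffunE -k_block /= permKV.
apply/subsetP => i iD; pose q := Ordinal (D_bound i iD).
rewrite inE; apply/existsP; exists q; rewrite eqxx /=.
have eq_k : k (s q) = k (s i).
  apply/eqP; have /= -> := k_block q; have /= -> := k_block i.
  by rewrite block_succ.
have := s_sorts i q; rewrite leEord /= leqnSn lexi_pair eq_k lexx.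
move/(_ isT) => /=; rewrite leEdual leEord => le_qi.
have ne_iq : s i != s q by rewrite (inj_eq perm_inj) -val_eqE /=; lia.
have : ~~ inc (s i) (s q) by apply/negP => /k_proper; rewrite eq_k eqxx.
rewrite /incomparable ne_iq /= negb_and !negbK => /orP[/lt_nat|//].
by rewrite ltnNge le_qi.
Qed.

Lemma card_perms_with_descents j : (forall i, i \in D -> (i.+1 < n)%N) ->
  #|perms_with_descents lt_P D j| = #|colorings inc j (content block)|.
Proof.
move=> D_bound; rewrite -(card_in_imset (f := block_coloring)); last first.
  move=> s t; rewrite !inE => /andP[_ s_des] /andP[_ t_des].
  by apply: block_coloring_inj; rewrite inE.
apply: eq_card => k; rewrite inE.
apply/imsetP/and3P => [[s] | [k_proper /eqP <- /'forall_eqP k_content]].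
  rewrite inE => /andP[/eqP <- s_des] ->.
  rewrite proper_block_coloring // card_descent_edges_block_coloring //.
  by split=> //; apply/forallP => c; rewrite content_block_coloring.
have [s s_des <-] := block_coloring_surj D_bound k_proper k_content.
by exists s; rewrite // inE s_des card_descent_edges_block_coloring // eqxx.
Qed.

End Blocks.

Lemma Des_succ_lt n (lt_P : rel 'I_n) (s : 'S_n) i :
  i \in Des lt_P s -> (i.+1 < n)%N.
Proof. by rewrite inE => /existsP[q /andP[/eqP <- _]]. Qed.

Lemma card_perms_with_descents_palindromic n (lt_P : rel 'I_n) D j :
  natural_unit_interval_order lt_P -> (j <= #|inc_edges lt_P|)%N ->
  #|perms_with_descents lt_P D j| =
  #|perms_with_descents lt_P D (#|inc_edges lt_P| - j)|.
Proof.
move=> P_interval le_jE; have [[_ lt_tr] lt_nat _] := P_interval.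
have inc_irr : irreflexive (incomparable lt_P).
  by move=> x; rewrite /incomparable eqxx.
have card_edges := card_edge_set (incomparable_sym lt_P) inc_irr.
have [/forall_inP D_bound | /forall_inPn[i iD i_last]] :=
    boolP [forall i in D, (i.+1 < n)%N].
  rewrite !card_perms_with_descents // [X in (X - j)%N]card_edges.
  apply: card_colorings_palindromic; last by rewrite -card_edges.
    exact: incomparable_sym.
  exact: incomparable_umbrella.
have no_perm l : #|perms_with_descents lt_P D l| = 0.
  apply: eq_card0 => s; rewrite inE; apply: contraNF i_last.
  by case/andP=> _ /subsetP/(_ i iD)/Des_succ_lt.
by rewrite !no_perm.
Qed.

Lemma a_poly_perms_with_descents n (lt_P : rel 'I_n) j :
  a_poly lt_P j = (\sum_(D : {set 'I_n})
    (\prod_(i in D) ('X^(i.+1) - 1)) *+ #|perms_with_descents lt_P D j|)%R.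
Proof.
rewrite /a_poly; under eq_bigr do rewrite /maj expr_sum prod_sum_subsets.
rewrite (exchange_big_dep predT) //=; apply: eq_bigr => D _.
by rewrite sumr_const cardsE.
Qed.

Theorem theorem3p2 (n : nat) (lt_P : rel 'I_n) :
  natural_unit_interval_order lt_P ->
  forall j : nat, (j <= #|inc_edges lt_P|)%N ->
    a_poly lt_P j = a_poly lt_P (#|inc_edges lt_P| - j)%N.
Proof.
move=> P_interval j le_jE; rewrite !a_poly_perms_with_descents.
apply: eq_bigr => D _.
by rewrite card_perms_with_descents_palindromic.
Qed.
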